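(* There exists an absolute constant $c>0$ such that the following holds. Let $k \geq 3$ and let $G$ be a finite triangle-free graph with $\iota(G) \geq k$. Then there is an integer $m$ such that $G$ contains a cycle of length $\ell$ for every integer $\ell$ with $m \leq \ell < m + c\,k^2\log k$; that is, $G$ contains cycles of at least $c\,k^2 \log k$ consecutive lengths.
   Context: All graphs are finite and simple. For $X \subseteq V(G)$ nonempty, $\alpha(X)$ denotes the independence number of the subgraph of $G$ induced by $X$. The independence ratio of $G$ is $\iota(G) := \sup_{\emptyset\neq X \subseteq V(G)} |X|/\alpha(X)$. $\log$ denotes the natural logarithm. The paper states the conclusion as ''cycles of $\Omega(k^2\log k)$ consecutive lengths''. *)

(* Defs.v *)
From HB Require Import structures.
From mathcomp Require Import all_boot all_order all_algebra.
From mathcomp Require Import classical_sets reals.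
Set Implicit Arguments.
Unset Strict Implicit.
Unset Printing Implicit Defensive.
Import Order.TTheory GRing.Theory Num.Theory.
Local Open Scope ring_scope.

(* A finite simple graph is a symmetric irreflexive [e : rel T] on a finType
   [T]; symmetry and irreflexivity are hypotheses of the theorem. *)

Definition independent (T : finType) (e : rel T) (S : {set T}) : bool :=
  [forall x in S, forall y in S, ~~ e x y].

Definition alpha (T : finType) (e : rel T) (X : {set T}) : nat :=
  \max_(S : {set T} | (S \subset X) && independent e S) #|S|.

(* For the graph with no vertices this is [sup set0], which is 0. *)
Definition indep_ratio (R : realType) (T : finType) (e : rel T) : R :=
  sup [set #|X|%:R / (alpha e X)%:R | X in [set X : {set T} | X != finset.set0]]%classic.

Definition triangle_free (T : finType) (e : rel T) : Prop :=
  forall x y z : T, ~ [/\ e x y, e y z & e z x].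

(* [ucycle] alone also accepts sequences of size 0 and, for a symmetric
   relation, 2; hence the bound on the length. *)
Definition has_cycle_of_length (T : finType) (e : rel T) (l : nat) : Prop :=
  (3 <= l)%N /\ exists2 s : seq T, ucycle e s & size s = l.

(* Main.v *)
Require Import Defs.
From HB Require Import structures.
From mathcomp Require Import all_boot all_order all_algebra.
From mathcomp Require Import zify ring lra.
Set Implicit Arguments.
Unset Strict Implicit.
Unset Printing Implicit Defensive.
Import Order.TTheory GRing.Theory Num.Theory.
Local Open Scope ring_scope.

(* Let Z be a minimal nonempty set with |Z| / alpha(Z) >= kap.  Then Z is
   connected and every independent I in Z satisfies |I u N_Z(I)| >= kap |I|.
   Triangle-free sets S with at most c k^2 log k vertices have
   alpha(S) >= 16 |S| / k (Ajtai-Komlos-Szemeredi), so for kap = k/4 all such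
   sets S expand, and depth-first search from any vertex of Z gives a path with
   more than c k^2 log k vertices.
   By parity of the distance in a breadth-first forest there is such a minimal
   set Z for k/2, and it lies in one level.  Let h be least such that all of Z
   has the same h-th ancestor, and split Z according to (h-1)-th ancestors into
   two nonempty parts so that one of them contains a minimal set Z' for k/4.
   Vertices of different parts are joined by a path of length 2h below the
   level.  A path in Z from Z' to the other part, leaving Z' at once at q,
   preceded by initial segments of a long path of Z' starting at q, gives paths
   of consecutive lengths between the two parts, and these close up to cycles. *)

(** * Independence number and neighbourhoods *)

Section Graph.
Variables (T : finType) (e : rel T).

Lemma independentP (S : {set T}) :
  reflect {in S &, forall x y, ~~ e x y} (independent e S).
Proof.
apply: (iffP forall_inP) => [H x y xS yS|H x xS].
  by have /forall_inP := H x xS; apply.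
by apply/forall_inP => y yS; exact: H.
Qed.

Lemma independent0 : independent e set0.
Proof. by apply/independentP => x y; rewrite inE. Qed.

Lemma alpha_ge (X S : {set T}) :
  S \subset X -> independent e S -> (#|S| <= alpha e X)%N.
Proof.
by move=> SX iS; apply: (@bigop.bigmax_sup _ S) => //; rewrite SX.
Qed.

Lemma alpha_witness (X : {set T}) :
  exists S : {set T}, [/\ S \subset X, independent e S & #|S| = alpha e X].
Proof.
pose P (S : {set T}) := (S \subset X) && independent e S.
have P0 : P set0 by rewrite /P sub0set independent0.
exists [arg max_(S > set0 | P S) #|S|]%N.
rewrite /alpha (@bigop.bigmax_eq_arg _ set0 P _ P0).
by case: arg_maxnP => // S /andP[].
Qed.

Lemma alpha_mono (X Y : {set T}) : X \subset Y -> (alpha e X <= alpha e Y)%N.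
Proof.
move=> XY; have [S [SX iS <-]] := alpha_witness X.
by apply: alpha_ge => //; apply: subset_trans XY.
Qed.

Hypothesis sym_e : symmetric e.

(** Maximum independent sets of the two parts have an independent union. *)
Lemma alpha_disconnected (X X1 X2 : {set T}) :
  X1 \subset X -> X2 \subset X -> [disjoint X1 & X2] ->
  {in X1 & X2, forall x y, ~~ e x y} ->
  (alpha e X1 + alpha e X2 <= alpha e X)%N.
Proof.
move=> s1 s2 dj ne.
have [S1 [S1X iS1 <-]] := alpha_witness X1.
have [S2 [S2X iS2 <-]] := alpha_witness X2.
have -> : (#|S1| + #|S2| = #|S1 :|: S2|)%N.
  rewrite cardsU (_ : S1 :&: S2 = set0) ?cards0 ?subn0 //.
  by apply: disjoint_setI0; apply: disjointWl S1X (disjointWr S2X dj).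
apply: alpha_ge.
  by rewrite subUset (subset_trans S1X) // (subset_trans S2X).
move/independentP: iS1 => iS1; move/independentP: iS2 => iS2.
apply/independentP => x y; rewrite !inE.
move=> /orP[xS|xS] /orP[yS|yS]; [exact: iS1| | |exact: iS2].
  by apply: ne; [exact: (subsetP S1X)|exact: (subsetP S2X)].
by rewrite sym_e; apply: ne; [exact: (subsetP S1X)|exact: (subsetP S2X)].
Qed.

Hypothesis irr_e : irreflexive e.

Lemma alpha_gt0 (X : {set T}) : X != set0 -> (0 < alpha e X)%N.
Proof.
move=> /set0Pn[x xX]; rewrite -(cards1 x); apply: alpha_ge; first by rewrite sub1set.
by apply/independentP => y z /set1P-> /set1P->; rewrite irr_e.
Qed.

Definition closed_nbhd (Z S : {set T}) : {set T} :=
  [set y in Z | (y \in S) || [exists x in S, e x y]].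

Lemma closed_nbhdS (Z S S' : {set T}) :
  S \subset S' -> closed_nbhd Z S \subset closed_nbhd Z S'.
Proof.
move=> /subsetP sS; apply/subsetP => y; rewrite !inE => /andP[-> /orP[/sS->//|]].
by case/exists_inP => x /sS xS exy; apply/orP; right; apply/exists_inP; exists x.
Qed.

(** * Minimal sets of large independence ratio *)

Section Critical.
Variable R : realFieldType.

(* Minimality yields both connectedness and expansion. *)
Definition critical (kap : R) (Z : {set T}) : Prop :=
  [/\ Z != set0, kap * (alpha e Z)%:R <= #|Z|%:R &
      forall Y : {set T}, Y \proper Z -> Y != set0 ->
        #|Y|%:R < kap * (alpha e Y)%:R].

Lemma critical_exists (kap : R) (X : {set T}) :
  X != set0 -> kap * (alpha e X)%:R <= #|X|%:R ->
  exists2 Z : {set T}, Z \subset X & critical kap Z.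
Proof.
move=> X0 kX.
pose P (Z : {set T}) :=
  [&& Z \subset X, Z != set0 & kap * (alpha e Z)%:R <= #|Z|%:R].
have PX : P X by rewrite /P subxx X0.
case: (arg_minnP (fun Z : {set T} => #|Z|) PX) => Z /and3P[ZX Z0 kZ] min.
exists Z => //; split=> // Y YZ Y0; rewrite ltNge; apply/negP => kY.
have := proper_card YZ; rewrite ltnNge min // /P Y0 kY.
by rewrite (subset_trans (proper_sub YZ)).
Qed.

(** Otherwise [Y] and [Z :\: Y] are both nonempty and proper, so minimality gives a strict upper
    bound for each. Without edges between them their independence numbers add up to at most
    [alpha e Z], so the sum of the two bounds contradicts the lower bound for [Z]. *)
Lemma critical_connected (kap : R) (Z Y : {set T}) :
  0 <= kap -> critical kap Z -> Y \subset Z -> Y != set0 ->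
  {in Y & Z :\: Y, forall x y, ~~ e x y} -> Y = Z.
Proof.
move=> k0 [Z0 kZ cZ] YZ Y0 ne; apply/eqP; rewrite eqEsubset YZ /= -setD_eq0.
apply/negPn/negP => D0.
have pY : Y \proper Z by rewrite properE YZ -setD_eq0.
have pD : Z :\: Y \proper Z.
  rewrite properE subsetDl /=; apply/negP => /subsetP sub.
  by case/set0Pn: Y0 => y yY; have := sub y (subsetP YZ y yY); rewrite inE yY.
have h1 := cZ _ pY Y0; have h2 := cZ _ pD D0.
have dj : [disjoint Y & Z :\: Y].
  by rewrite -setI_eq0; apply/eqP/setP => x; rewrite !inE; case: (x \in Y).
have := alpha_disconnected YZ (subsetDl Z Y) dj ne.
rewrite -(ler_nat R) natrD => h3.
have h4 : #|Z|%:R = #|Y|%:R + #|Z :\: Y|%:R :> R.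
  by rewrite -natrD -(cardsID Y Z) (setIidPr YZ).
have := ler_wpM2l k0 h3; lra.
Qed.

(** A maximum independent set outside the closed neighbourhood [N] of [I] stays independent when [I]
    is added. Removing [N] therefore costs at least [#|I|] in [alpha], while minimality bounds the
    size of what remains. *)
Lemma critical_expand (kap : R) (Z I : {set T}) :
  0 <= kap -> critical kap Z -> I \subset Z -> independent e I ->
  kap * #|I|%:R <= #|closed_nbhd Z I|%:R.
Proof.
move=> k0 [Z0 kZ cZ] IZ iI.
have [->|I0] := eqVneq I set0; first by rewrite cards0 mulr0.
set N := closed_nbhd Z I.
have IN : I \subset N by apply/subsetP => x xI; rewrite inE (subsetP IZ) ?xI.
have NZ : N \subset Z by apply/subsetP => x; rewrite inE => /andP[].
have hD : #|Z :\: N|%:R <= kap * (alpha e (Z :\: N))%:R.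
  have [->|D0] := eqVneq (Z :\: N) set0; first by rewrite cards0 mulr_ge0.
  apply/ltW/cZ => //; rewrite properE subsetDl /=; apply/negP => /subsetP sub.
  case/set0Pn: I0 => y yI; have := sub y (subsetP IZ y yI).
  by rewrite inE (subsetP IN).
have dj : [disjoint I & Z :\: N].
  apply/pred0P => x /=; case xI: (x \in I) => //=.
  by rewrite in_setD (subsetP IN).
have ne : {in I & Z :\: N, forall x y, ~~ e x y}.
  move=> x y xI; rewrite inE => /andP[yN yZ]; apply: contra yN => exy.
  by rewrite inE yZ; apply/orP; right; apply/exists_inP; exists x.
have h1 := alpha_disconnected IZ (subsetDl Z N) dj ne.
have h2 : (#|I| + alpha e (Z :\: N) <= alpha e Z)%N.
  by apply: leq_trans h1; rewrite leq_add2r; apply: alpha_ge.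
move: h2; rewrite -(ler_nat R) natrD => h2.
have h4 : #|Z|%:R = #|N|%:R + #|Z :\: N|%:R :> R.
  by rewrite -natrD -(cardsID N Z) (setIidPr NZ).
have := ler_wpM2l k0 h2; lra.
Qed.

(** If both classes of [P] had ratio below [kap / 2], adding their sizes would give ratio below
    [kap] for [X], because [alpha] of each class is at most [alpha e X]. The better class then
    contains a critical set. *)
Lemma critical_half (kap : R) (X : {set T}) (P : pred T) :
  0 <= kap -> X != set0 -> kap * (alpha e X)%:R <= #|X|%:R ->
  exists b : bool,
    exists2 Z : {set T}, Z \subset [set x in X | P x == b] & critical (kap / 2) Z.
Proof.
move=> k0 X0 kX; pose Y b := [set x in X | P x == b].
have YX b : Y b \subset X by apply/subsetP => x; rewrite inE => /andP[].
case: (boolP [exists b, (Y b != set0) && (kap / 2 * (alpha e (Y b))%:R <= #|Y b|%:R)]).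
  case/existsP => b /andP[Y0 kY]; exists b.
  exact: critical_exists Y0 kY.
rewrite negb_exists => /forallP H.
have lt b : Y b != set0 -> #|Y b|%:R < kap / 2 * (alpha e (Y b))%:R.
  by move=> Y0; have := H b; rewrite Y0 /= -ltNge.
have le b : #|Y b|%:R <= kap / 2 * (alpha e (Y b))%:R.
  have [->|Y0] := eqVneq (Y b) set0; last exact: ltW (lt b Y0).
  by rewrite cards0 mulr_ge0 // divr_ge0.
have cX : #|X|%:R = #|Y true|%:R + #|Y false|%:R :> R.
  rewrite -natrD; congr (_%:R).
  rewrite -(cardsID [set x | P x] X); congr (_ + _)%N; apply: eq_card => x.
    by rewrite !inE; case: (P x).
  by rewrite !inE andbC; case: (P x).
have m b : kap / 2 * (alpha e (Y b))%:R <= kap / 2 * (alpha e X)%:R.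
  by apply: ler_wpM2l; [rewrite divr_ge0|rewrite ler_nat alpha_mono].
case/set0Pn: (X0) => x xX.
have Yx : Y (P x) != set0 by apply/set0Pn; exists x; rewrite inE xX eqxx.
move: (m true) (m false) (le true) (le false) => *.
by case: (P x) Yx => /lt; lra.
Qed.

End Critical.

(** * Long paths in expanding sets *)

Lemma expander_path (Z : {set T}) (q : T) (s : nat) :
  q \in Z ->
  (forall S : {set T}, S \subset Z -> S != set0 -> (#|S| <= s)%N ->
     (2 * #|S| < #|closed_nbhd Z S|)%N) ->
  exists u : seq T,
    [/\ path e q u, uniq (q :: u), {subset q :: u <= Z} & (s <= size u)%N].
Proof.
move=> qZ expand.
(* Depth-first search: [D] is the set of finished vertices and [x :: p] the
   stack, which is a path from its top [x] down to [q]. *)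
suff H m (D : {set T}) x p :
    (2 * #|Z| <= m + 2 * #|D| + size p)%N -> D \subset Z -> (#|D| <= s)%N ->
    path e x p -> last x p = q -> uniq (x :: p) -> {subset x :: p <= Z} ->
    {in x :: p, forall y, y \notin D} ->
    (forall y z, y \in D -> z \in Z -> e y z -> (z \in D) || (z \in x :: p)) ->
    exists y u, [/\ path e y u, last y u = q, uniq (y :: u),
                    {subset y :: u <= Z} & (s <= size u)%N].
  have [|||||||||y [u [pu lu uu su szu]]] :=
      H (2 * #|Z|)%N set0 q [::]; rewrite ?cards0 ?sub0set ?muln0 ?addn0 //=.
  - by move=> y; rewrite inE => /eqP->.
  - by move=> y _; rewrite inE.
  - by move=> y z; rewrite inE.
  have E : q :: rev (belast y u) = rev (y :: u) by rewrite [y :: u]lastI rev_rcons lu.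
  exists (rev (belast y u)); split; last by rewrite size_rev size_belast.
  - by rewrite -lu rev_path; apply: sub_path pu => a b; rewrite /= sym_e.
  - by move: uu; rewrite -rev_uniq -E.
  - by move=> z; rewrite E mem_rev; apply: su.
(* Pushing a vertex and finishing the top each raise [2 * #|D| + size p] by one, so [m] bounds the
   number of steps left. *)
elim: m D x p => [|m IH] D x p hm DZ Ds px lx ux sx dx nx.
  exfalso.
  have : (#|D| + (size p).+1 <= #|Z|)%N; last by lia.
  rewrite -(card_uniqP ux : _ = (size p).+1) -cardUI [X in (_ + X)%N]eq_card0.
    rewrite addn0; apply: subset_leq_card; apply/subsetP => z.
    by rewrite inE => /orP[|/sx//]; apply: (subsetP DZ).
  by move=> z; rewrite inE; apply/negP => /andP[zD /dx]; rewrite zD.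
(* Once [s] vertices are finished, their closed neighbourhood has more than [2 * s] vertices and
   lies in [D] and the stack, so the stack holds more than [s] vertices. *)
move: Ds; rewrite leq_eqVlt => /orP[/eqP Ds|Ds].
  exists x, p; split=> //.
  case: (posnP s) => [->//|s0].
  have D0 : D != set0 by rewrite -card_gt0 Ds.
  have := expand D DZ D0; rewrite Ds leqnn => /(_ isT) h.
  have : (#|closed_nbhd Z D| <= #|D| + (size p).+1)%N; last by lia.
  rewrite -(card_uniqP ux : _ = (size p).+1) -cardUI; apply: leq_trans (leq_addr _ _).
  apply: subset_leq_card; apply/subsetP => z.
  rewrite inE => /andP[zZ /orP[zD|/exists_inP[y yD eyz]]]; rewrite inE.
    by rewrite zD.
  exact: nx eyz.
case: (boolP [exists y in Z, [&& e x y, y \notin D & y \notin x :: p]]).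
  case/exists_inP => y yZ /and3P[exy yD yp].
  apply: (IH D y (x :: p)) => //=.
  - by lia.
  - exact: ltnW.
  - by rewrite sym_e exy.
  - by rewrite yp.
  - by move=> z; rewrite inE => /orP[/eqP->//|]; apply: sx.
  - by move=> z; rewrite inE => /orP[/eqP->//|]; apply: dx.
  - by move=> a b aD bZ eab; rewrite inE orbCA (nx a b) ?orbT.
rewrite negb_exists => /forallP noy.
have xD : x \notin D by apply: dx; rewrite inE eqxx.
have DxZ : x |: D \subset Z by rewrite subUset sub1set sx ?inE ?eqxx.
have cx : #|x |: D| = #|D|.+1 by rewrite cardsU1 xD.
have nx' y z : y \in x |: D -> z \in Z -> e y z -> (z \in x |: D) || (z \in p).
  move=> yD zZ eyz; suff : (z \in D) || (z \in x :: p).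
    by rewrite !inE; case: (z == x); case: (z \in D).
  move: yD; rewrite in_setU1 => /orP[/eqP yx|yD]; last exact: nx eyz.
  apply: contraR (noy z); rewrite negb_or => /andP[zD zp].
  by rewrite zZ -yx eyz zD yx zp.
case: p px lx ux sx dx nx hm noy nx' => [|x' p] px lx ux sx dx nx hm noy nx'.
  (* If the stack ran empty, [x |: D] would contain its whole closed neighbourhood in [Z], against
     expansion. *)
  exfalso.
  have N0 : x |: D != set0 by apply/set0Pn; exists x; rewrite !inE eqxx.
  have := expand _ DxZ N0; rewrite cx => /(_ Ds).
  have : (#|closed_nbhd Z (x |: D)| <= #|x |: D|)%N.
    apply: subset_leq_card; apply/subsetP => z.
    rewrite inE => /andP[zZ /orP[//|/exists_inP[y yD eyz]]].
    by have := nx' y z yD zZ eyz; rewrite orbF.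
  by rewrite cx; lia.
move: px ux => /= /andP[_ px] /andP[xp ux].
apply: (IH (x |: D) x' p) => //.
- by move: hm; rewrite cx /=; lia.
- by rewrite cx.
- by move=> z zp; apply: sx; rewrite inE zp orbT.
- move=> z zp; rewrite !inE negb_or dx ?andbT; last by rewrite inE zp orbT.
  by apply: contra xp => /eqP <-.
Qed.

End Graph.

(** * Independent sets in triangle-free graphs *)

Lemma sum_card_powerset (T : finType) (X : {set T}) :
  (2 * \sum_(Y in powerset X) #|Y| = #|X| * 2 ^ #|X|)%N.
Proof.
(* Complementation in [X] permutes its subsets, and each complementary pair has total size
   [#|X|]. *)
have E : (\sum_(Y in powerset X) #|Y| = \sum_(Y in powerset X) #|X :\: Y|)%N.
  have K (Y : {set T}) : X :\: (X :\: Y) = X :&: Y by rewrite setDDr setDv set0U.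
  rewrite (reindex_onto (fun Y => X :\: Y) (fun Y => X :\: Y)) /=; last first.
    by move=> Y; rewrite powersetE => /setIidPr YX; rewrite K.
  apply: eq_bigl => Y; rewrite !powersetE subsetDl K /=.
  by apply/eqP/idP => [<-|/setIidPr//]; exact: subsetIl.
rewrite mul2n -addnn {2}E -big_split /= -card_powerset mulnC -sum_nat_const.
apply: eq_bigr => Y; rewrite powersetE => /setIidPr YX.
by rewrite -(cardsID Y X) YX.
Qed.

Section Sparse.
Variables (T : finType) (e : rel T).
Hypotheses (sym_e : symmetric e) (irr_e : irreflexive e).
Hypothesis tf : triangle_free e.

(* Alon-Spencer: for a uniformly random independent set [W] the weight
   [d * (v \in W) + #|N v :&: W|] has mean at least [t / 4] at every vertex [v],
   while its sum over [v] is at most [2 * d * #|W|]. *)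
Section HardCore.
Variables (S : {set T}) (d t : nat).
Hypothesis degS : {in S, forall v, #|[set w in S | e v w]| <= d}%N.
Hypothesis td : (4 ^ t <= d)%N.

Let Ind := [set W : {set T} | (W \subset S) && independent e W].
Let N v := [set w in S | e v w].
Let f v (W : {set T}) := (d * (v \in W) + #|N v :&: W|)%N.

(* The sets of [Ind] with prescribed trace outside [v |: N v] are the trace
   with [v] added and the trace with any set of available neighbours added. *)
Lemma hardcore_fiber v (W1 : {set T}) : v \in S -> W1 \in Ind ->
  let W0 := W1 :\: (v |: N v) in
  exists2 X : {set T}, X \subset N v &
    [set W in Ind | W :\: (v |: N v) == W0]
      = (v |: W0) |: [set W0 :|: Y | Y : {set T} in powerset X].
Proof.
move=> vS; rewrite inE => /andP[W1S /independentP iW1] W0.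
(* The available neighbours are those with no neighbour in the trace. *)
exists [set w in N v | ~~ [exists z in W0, e w z]].
  by apply/subsetP => w; rewrite inE => /andP[].
have W0S : W0 \subset S by apply: subset_trans W1S; apply: subsetDl.
have iW0 : {in W0 &, forall x y, ~~ e x y}.
  by move=> x y; rewrite !in_setD => /andP[_ xW] /andP[_ yW]; apply: iW1.
have W0N y : y \in W0 -> ~~ e v y.
  move=> yW0; apply/negP => evy; move: (yW0); rewrite in_setD in_setU1.
  by rewrite !inE evy (subsetP W0S) ?orbT.
have vW0 : v \notin W0 by rewrite in_setD setU11.
have gW0 : W0 :\: (v |: N v) = W0 by rewrite /W0 setDDl setUid.
apply/setP => W; apply/idP/idP.
  rewrite inE => /andP[]; rewrite inE => /andP[WS /independentP iW] /eqP gW.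
  rewrite in_setU1; case: (boolP (v \in W)) => vW.
    apply/orP; left; apply/eqP/setP => x; rewrite in_setU1 -gW in_setD in_setU1.
    case: eqVneq => [->//|_] /=; case: (boolP (x \in W)) => xW; last by rewrite andbF.
    by rewrite inE (negbTE (iW _ _ vW xW)) andbF.
  apply/orP; right; apply/imsetP; exists (W :&: N v).
    rewrite powersetE; apply/subsetP => x /setIP[xW xN].
    rewrite inE xN /=; apply/exists_inP => -[z]; rewrite -gW => /setDP[zW _].
    by apply/negP; apply: iW.
  apply/setP => x; rewrite in_setU -gW in_setD in_setU1 in_setI.
  case: eqVneq => [->|_] /=; first by rewrite (negbTE vW).
  by case: (x \in W); case: (x \in N v).
rewrite in_setU1 => /orP[/eqP->|/imsetP[Y]].
  rewrite !inE subUset sub1set vS W0S /=; apply/andP; split.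
    apply/independentP => x y /setU1P[->|xW] /setU1P[->|yW].
    - by rewrite irr_e.
    - exact: W0N.
    - by rewrite sym_e; exact: W0N.
    - exact: iW0.
  apply/eqP; rewrite setDUl gW0; apply/setUidPr/subsetP => x.
  by rewrite in_setD in_set1 in_setU1 negb_or => /andP[/andP[/negbTE->]].
rewrite powersetE => /subsetP YX ->.
have YN : Y \subset N v by apply/subsetP => x /YX; rewrite inE => /andP[].
have YW z w : z \in Y -> w \in W0 -> ~~ e z w.
  move=> /YX; rewrite inE => /andP[_ H] wW; apply: contra H => ezw.
  by apply/exists_inP; exists w.
rewrite !inE subUset W0S /=; apply/andP; split; [apply/andP; split|].
- by apply: subset_trans YN _; apply/subsetP => x; rewrite inE => /andP[].
- apply/independentP => x y /setUP[xW|xY] /setUP[yW|yY].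
  + exact: iW0.
  + by rewrite sym_e; exact: YW.
  + exact: YW.
  (* Adjacent vertices of [N v] would form a triangle with [v]. *)
  + apply/negP => exy; move: (subsetP YN x xY) (subsetP YN y yY).
    rewrite !inE => /andP[_ evx] /andP[_ evy]; apply: (tf (x := v) (y := x) (z := y)).
    by split=> //; rewrite sym_e.
- rewrite setDUl gW0; apply/eqP/setUidPl/subsetP => x /setDP[xY].
  by rewrite in_setU1 (subsetP YN) ?orbT.
Qed.

(** Here [x] counts the available neighbours, so a fibre has [1 + 2 ^ x] sets. If [t <= x], the last
    term suffices; otherwise both factors on the left are at most [2 ^ t], and [4 ^ t <= d]. *)
Lemma hardcore_ineq x : (t * (1 + 2 ^ x) <= 4 * d + 2 * (x * 2 ^ x))%N.
Proof.
case: (leqP t x) => [tx|xt].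
  have p : (0 < 2 ^ x)%N by rewrite expn_gt0.
  apply: leq_trans (leq_addl _ _); rewrite [leqRHS]mulnCA; apply: leq_mul => //.
  by move: p; lia.
have h1 : (1 + 2 ^ x <= 2 ^ t)%N.
  have : (2 ^ x.+1 <= 2 ^ t)%N by rewrite leq_pexp2l.
  by have : (0 < 2 ^ x)%N by [rewrite expn_gt0]; rewrite expnS; lia.
have h2 : (t <= 2 ^ t)%N by apply/ltnW/ltn_expl.
apply: leq_trans (leq_mul h2 h1) _.
by rewrite -expnMn; apply: leq_trans td _; lia.
Qed.

(** The bound holds on each fibre of the trace map [g]: the set containing [v] contributes at least
    [d], and the others contribute the sizes of all subsets of [X]. *)
Lemma hardcore_local v : v \in S ->
  (t * #|Ind| <= 4 * \sum_(W in Ind) f v W)%N.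
Proof.
move=> vS; pose g (W : {set T}) := W :\: (v |: N v).
rewrite -sum1_card (partition_big_imset g) /= [leqRHS](congr1 _ (partition_big_imset g _ _)) /=.
rewrite !big_distrr /=.
apply: leq_sum => _ /imsetP[W1 W1I ->].
have [X XN E] := hardcore_fiber vS W1I; set W0 := W1 :\: _ in E.
have sumE (F : {set T} -> nat) :
  (\sum_(W in Ind | g W == W0) F W =
     F (v |: W0) + \sum_(Y in powerset X) F (W0 :|: Y))%N.
  rewrite (eq_bigl [in [set W in Ind | g W == W0]]); last by move=> W; rewrite inE.
  have vN : v \notin N v by rewrite inE irr_e andbF.
  rewrite E big_setU1 /=; last first.
    apply/imsetP => -[Y]; rewrite powersetE => YX EY.
    have : v \in v |: W0 by rewrite setU11.
    rewrite EY in_setU in_setD setU11 /= => /(subsetP YX)/(subsetP XN).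
    by apply/negP.
  rewrite big_imset //= => Y1 Y2; rewrite !powersetE => Y1X Y2X EY.
  (* Intersecting with [N v] recovers [Y], so the fibre is parametrized injectively. *)
  have R (Y : {set T}) : Y \subset X -> (W0 :|: Y) :&: N v = Y.
    move=> YX; apply/setP => x; rewrite in_setI in_setU in_setD in_setU1.
    have : x \in Y -> x \in N v by move=> /(subsetP YX)/(subsetP XN).
    by case: (x \in Y); case: (x \in N v); rewrite ?orbT ?andbF //= => /(_ isT).
  by rewrite -(R Y1 Y1X) EY R.
rewrite !sumE.
apply: (@leq_trans (t * (1 + 2 ^ #|X|))%N).
  by rewrite sum1_card card_powerset.
apply: leq_trans (hardcore_ineq _) _.
rewrite -sum_card_powerset mulnA mulnDr; apply: leq_add.
  by rewrite /f setU11; lia.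
rewrite leq_mul2l /=; apply: leq_sum => Y; rewrite powersetE => YX.
apply: leq_trans (leq_addl _ _); apply: subset_leq_card.
by rewrite subsetI (subset_trans YX XN) subsetUr.
Qed.

(** Double counting of the total weight: the local bounds are summed over [v], and the sums over [v]
    and [W] are exchanged. *)
Lemma card_mul_le_alpha : (#|S| * t <= 8 * d * alpha e S)%N.
Proof.
have I0 : (0 < #|Ind|)%N.
  by apply/card_gt0P; exists set0; rewrite inE sub0set independent0.
rewrite -(leq_pmul2r I0).
apply: (@leq_trans (\sum_(v in S) 4 * \sum_(W in Ind) f v W)%N).
  rewrite -mulnA -sum_nat_const; apply: leq_sum => v vS; exact: hardcore_local.
rewrite -big_distrr /= exchange_big /=.
have -> : (8 * d * alpha e S * #|Ind| = 4 * (#|Ind| * (2 * d * alpha e S)))%N by lia.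
rewrite leq_mul2l /= -sum_nat_const; apply: leq_sum => W WI.
move: (WI); rewrite inE => /andP[WS iW].
have Wa : (#|W| <= alpha e S)%N by apply: alpha_ge.
apply: (@leq_trans (2 * d * #|W|)%N); last by rewrite leq_mul2l Wa orbT.
rewrite /f big_split /= -mulnA mul2n -addnn; apply: leq_add.
  rewrite -big_distrr /= leq_mul2l; apply/orP; right.
  rewrite (eq_bigr (fun v => if v \in W then 1 else 0)%N); last first.
    by move=> v _; case: (v \in W).
  rewrite -big_mkcondr sum1_card.
  by apply: subset_leq_card; apply/subsetP => x /andP[].
have -> : (\sum_(v in S) #|N v :&: W| = \sum_(w in W) #|N w|)%N.
  transitivity (\sum_(v in S) \sum_(w in W) (e v w : nat))%N.
    apply: eq_bigr => v vS; rewrite -sum1_card [RHS]big_mkcond [RHS]big_mkcond /=.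
    rewrite big_mkcond; apply: eq_bigr => w _; rewrite !inE.
    by case: (boolP (w \in W)) => [/(subsetP WS)->|]; case: (e v w); rewrite ?andbF.
  rewrite exchange_big /=; apply: eq_bigr => w wW.
  rewrite -sum1_card [LHS]big_mkcond [RHS]big_mkcond; apply: eq_bigr => v _.
  by rewrite !inE (sym_e v w); case: (v \in S); case: (e w v).
rewrite mulnC -sum_nat_const; apply: leq_sum => w wW.
by apply: degS; apply: (subsetP WS).
Qed.

End HardCore.

(** Neighbourhoods are independent, so degrees in [S] are at most [alpha e S]. Taking [d] to be
    [4 * alpha e S] leaves room to round the base 4 logarithm up and still have [4 ^ t <= d]. *)
Lemma card_le_alpha_log (S : {set T}) : S != set0 ->
  exists t : nat, [/\ (0 < t)%N, (alpha e S < 4 ^ t)%N &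
    (#|S| * t <= 32 * alpha e S ^ 2)%N].
Proof.
move=> S0; have a0 := alpha_gt0 irr_e S0.
exists (trunc_log 4 (alpha e S)).+1; split=> //; first by rewrite trunc_log_ltn.
rewrite (_ : 32 * alpha e S ^ 2 = 8 * (4 * alpha e S) * alpha e S)%N; last by lia.
apply: card_mul_le_alpha => [v vS|].
  apply: (@leq_trans (alpha e S)); last by lia.
  apply: alpha_ge; first by apply/subsetP => w; rewrite inE => /andP[].
  apply/independentP => x y; rewrite !inE => /andP[_ evx] /andP[_ evy].
  apply/negP => exy; apply: (tf (x := v) (y := x) (z := y)); split=> //.
  by rewrite sym_e.
by rewrite expnS leq_mul2l /= trunc_logP.
Qed.

End Sparse.

(** * Breadth-first levels and cycles through a common ancestor *)

Lemma eq_of_parity (m n : nat) :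
  odd m = odd n -> (m <= n.+1)%N -> (n <= m.+1)%N -> m = n.
Proof.
have H a b : odd a = odd b -> (a <= b.+1)%N -> (b < a)%N -> a = b.
  move=> o ab ba; have E : a = b.+1 by apply/eqP; rewrite eqn_leq ab ba.
  by move: o; rewrite E /=; case: (odd b).
move=> o mn nm; case: (ltngtP m n) => // [lt|lt]; last exact: H.
by apply/esym/H.
Qed.

Section Levels.
Variables (T : finType) (e : rel T).
Hypotheses (sym_e : symmetric e) (irr_e : irreflexive e).

(* [r x] is the root of the component of [x], [d x] the distance from [r x] to
   [x] and [par] the parent function of a breadth-first forest. *)
Lemma bfs_exists : exists (r : T -> T) (d : T -> nat) (par : T -> T),
  [/\ forall x y, e x y -> r x = r y,
      forall x, d x = 0 -> r x = x,
      forall x y, e x y -> (d x <= (d y).+1)%N &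
      forall x, (0 < d x)%N -> e x (par x) /\ d x = (d (par x)).+1].
Proof.
have csym := sym_connect_sym sym_e.
(* Quantifying over tuples of fixed length keeps [reach] boolean, as [ex_minn] requires. *)
pose reach x n := [exists p : n.-tuple T, path e (fingraph.root e x) p && (last (fingraph.root e x) p == x)].
have reachP x n : reflect (exists p, [/\ path e (fingraph.root e x) p, last (fingraph.root e x) p = x & size p = n])
    (reach x n).
  apply: (iffP existsP) => [[p /andP[pp /eqP lp]]|[p [pp lp /eqP sp]]].
    by exists p; rewrite size_tuple.
  by exists (Tuple sp); rewrite /= pp lp eqxx.
have exr x : exists n, reach x n.
  have : connect e (fingraph.root e x) x by rewrite csym connect_root.
  case/connectP => p pp lp; exists (size p); apply/reachP; exists p; split=> //.
pose d x := ex_minn (exr x).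
have dr x : reach x (d x) by rewrite /d; case: ex_minnP.
have dmin x n : reach x n -> (d x <= n)%N.
  by rewrite /d; case: ex_minnP => m _; apply.
have rE x y : e x y -> fingraph.root e x = fingraph.root e y by move=> exy; apply/(fingraph.rootP csym)/connect1.
have dE x y : e x y -> (d x <= (d y).+1)%N.
  move=> exy; have /reachP[p [pp lp <-]] := dr y.
  apply: dmin; apply/reachP; exists (rcons p x).
  by rewrite (rE _ _ exy) rcons_path last_rcons size_rcons pp lp sym_e.
exists (fingraph.root e), d, (fun x => odflt x [pick y | e x y && (d x == (d y).+1)]).
split=> // x dx.
  by have /reachP[p [_ lp sp]] := dr x; case: p lp sp => //; rewrite dx.
(* The default is not taken at positive depth: the last vertex before [x] on a shortest walk from
   the root qualifies. *)
case: pickP => [y /andP[exy /eqP]//|no] /=; exfalso.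
have /reachP[p [pp lp sp]] := dr x; case/lastP: p pp lp sp => [|p z].
  by move=> _ _ s0; rewrite -s0 in dx.
rewrite rcons_path last_rcons size_rcons => /andP[pp ez] zx sp; subst z.
have exy : e x (last (fingraph.root e x) p) by rewrite sym_e.
have := no (last (fingraph.root e x) p); rewrite exy /= => /negP; apply; rewrite eqn_leq dE //=.
rewrite -sp ltnS; apply: dmin; apply/reachP; exists p.
by rewrite -(rE _ _ exy).
Qed.

Section Parent.
Variables (d : T -> nat) (par : T -> T).
Hypothesis parP : forall x, (0 < d x)%N -> e x (par x) /\ d x = (d (par x)).+1.

Lemma depth_iter_parent x j : (j <= d x)%N -> d (iter j par x) = (d x - j)%N.
Proof.
elim: j => [|j IH] jd; first by rewrite subn0.
have E := IH (ltnW jd); have /parP[_] : (0 < d (iter j par x))%N by rewrite E; lia.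
by rewrite E iterS; lia.
Qed.

Lemma path_parent x h : (h <= d x)%N -> path e x (traject par (par x) h).
Proof.
elim: h x => //= h IH x hd; have [-> E] : e x (par x) /\ d x = (d (par x)).+1.
  by apply: parP; lia.
by apply: IH; lia.
Qed.

Lemma uniq_parent x h : (h <= d x)%N -> uniq (traject par x h.+1).
Proof.
elim: h x => //= h IH x hd; have [_ E] : e x (par x) /\ d x = (d (par x)).+1.
  by apply: parP; lia.
rewrite -trajectS IH ?andbT; last by lia.
apply/trajectP => -[j jh xE]; have := @depth_iter_parent (par x) j.
by rewrite -xE; lia.
Qed.

(** The path is closed by climbing from its end to the common ancestor and descending to [a]. These
    ancestors have depth below [i], and an earlier meeting of the two climbs would force equal
    [h]-th ancestors. *)
Lemma cycle_through_ancestor i h a p :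
  {in a :: p, forall z, d z = i} -> path e a p -> uniq (a :: p) ->
  (h < i)%N -> iter h par a != iter h par (last a p) ->
  iter h.+1 par a = iter h.+1 par (last a p) ->
  has_cycle_of_length e (size p + 2 * h.+1).
Proof.
set b := last a p => dp pp up hi ne eq.
have da : d a = i by apply: dp; rewrite inE eqxx.
have db : d b = i by apply: dp; apply: mem_last.
have p0 : (0 < size p)%N by case: (p) @b ne {eq db dp pp up} => //=; rewrite eqxx.
split; first by lia.
(* [t1] includes the common ancestor; [t2] stops just below it. *)
set t1 := traject par (par b) h.+1; set t2 := traject par (par a) h.
exists (a :: p ++ t1 ++ rev t2); last first.
  by rewrite -cat_cons !size_cat size_rev !size_traject /=; lia.
have dt x j : d x = i -> (j <= h)%N -> d (iter j par (par x)) = (i - j.+1)%N.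
  by move=> dx jh; rewrite -iterSr depth_iter_parent dx //; lia.
apply/andP; split.
  rewrite -[cycle e _]/(path e a (rcons (p ++ t1 ++ rev t2) a)).
  rewrite rcons_cat cat_path pp -/b rcons_cat cat_path.
  have -> : path e b t1 by apply: path_parent; rewrite db.
  rewrite last_traject -eq -rev_cons.
  have := rev_path e a (traject par (par a) h.+1).
  rewrite last_traject trajectSr belast_rcons => ->.
  rewrite -trajectSr; apply: sub_path (path_parent _) => [x y|]; last by lia.
  by rewrite sym_e.
have ut x n : d x = i -> (n <= h.+1)%N -> uniq (traject par (par x) n).
  move=> dx nh; have := @uniq_parent x n; rewrite dx => /(_ (leq_trans nh hi)).
  by rewrite trajectS => /andP[].
rewrite -cat_cons !cat_uniq up rev_uniq !ut // andbT has_cat negb_or !has_rev.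
rewrite 2!andTb -andbA; apply/and3P; split.
- apply/hasPn => x /trajectP[j jh ->]; apply/negP => /dp.
  by rewrite dt //; lia.
- apply/hasPn => x /trajectP[j jh ->]; apply/negP => /dp.
  by rewrite dt //; lia.
apply/hasPn => x /trajectP[j jh ->]; apply/negP => /trajectP[l lh E].
have jl : j = l.
  have := congr1 d E; rewrite !dt //; [lia|exact: ltnW].
case/negP: ne; apply/eqP.
have -> : h = ((h - j.+1) + j.+1)%N by lia.
by rewrite !iterD !iterSr E jl.
Qed.

End Parent.

(** * Paths in critical sets and consecutive cycle lengths *)

Lemma last_exit (P : pred T) x p :
  path e x p -> has P (x :: p) ->
  exists q p', [/\ P q, path e q p', last q p' = last x p, ~~ has P p' &
                   subseq (q :: p') (x :: p)].
Proof.
elim: p x => [|y p IH] x.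
  by move=> _; rewrite /= orbF => Px; exists x, [::]; split=> //=; rewrite eqxx.
move=> /= /andP[exy pp] H.
case: (boolP (has P (y :: p))) => [Hy|nH].
  have [q [p' [Pq pq lq nq sq]]] := IH y pp Hy.
  exists q, p'; split=> //; exact: (subseq_trans sq (subseq_cons _ _)).
exists x, (y :: p); split=> //.
- by move: H nH => /= /orP[//|->].
- by rewrite /= exy.
- by rewrite eqxx eqxx subseq_refl.
Qed.

(** The part of [Z] reachable from [x] inside [Z] sends no edge to the rest of [Z], so by
    [critical_connected] it is all of [Z]. *)
Lemma critical_path (R : realFieldType) (kap : R) (Z : {set T}) x y :
  0 <= kap -> critical e kap Z -> x \in Z -> y \in Z ->
  exists p, [/\ path e x p, last x p = y, uniq (x :: p) & {subset x :: p <= Z}].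
Proof.
move=> k0 Zc xZ yZ; pose eZ := [rel u v | e u v && (v \in Z)].
have E : [set z in Z | connect eZ x z] = Z.
  apply: (critical_connected sym_e k0 Zc).
  - by apply/subsetP => z; rewrite inE => /andP[].
  - by apply/set0Pn; exists x; rewrite inE xZ connect0.
  - move=> u v; rewrite !inE => /andP[uZ xu] /andP[H vZ].
    apply: contra H => euv; rewrite vZ /=; apply: connect_trans xu _.
    by apply: connect1; rewrite /= euv.
have : y \in [set z in Z | connect eZ x z] by rewrite E.
rewrite inE => /andP[_ /connectP[p0 pp0 ->]].
case: (shortenP pp0) => p pp up _; exists p; split=> //.
  by apply: sub_path pp => u v /andP[].
elim: p x xZ pp {up E pp0} => [|z p IH] x xZ /=.
  by move=> _ w; rewrite mem_seq1 => /eqP->.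
move=> /andP[/andP[_ zZ] pp] w; rewrite inE => /orP[/eqP->//|].
exact: IH.
Qed.

Lemma consecutive_cycles (R : realFieldType) (k : R) (s : nat) (X : {set T}) :
  3 <= k -> X != set0 -> k * (alpha e X)%:R <= #|X|%:R ->
  (forall S : {set T}, S != set0 -> (#|S| <= s)%N ->
     16 * #|S|%:R <= k * (alpha e S)%:R) ->
  exists m, forall j, (j <= s)%N -> has_cycle_of_length e (m + j).
Proof.
move=> k3 X0 kX sparse.
have [r [d [par [rE r0 dE parP]]]] := bfs_exists.
have k0 : 0 <= k by lra.
have k20 : 0 <= k / 2 by lra.
have k40 : 0 <= k / 2 / 2 by lra.
have [b [Z /subsetP Zb Zc]] := critical_half (fun x => odd (d x)) k0 X0 kX.
have [Z0 kZ _] := Zc; case/set0Pn: (Z0) => x0 x0Z.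
have oddZ z : z \in Z -> odd (d z) = b by move=> /Zb; rewrite inE => /andP[_ /eqP].
pose i := d x0.
have dZ z : z \in Z -> d z = i.
  (* Depths of adjacent vertices differ by at most one and have equal parity in [Z], so no edge of
     [Z] changes level. *)
  suff <- : [set z in Z | d z == i] = Z by rewrite inE => /andP[_ /eqP].
  apply: (critical_connected sym_e k20 Zc).
  - by apply/subsetP => y; rewrite inE => /andP[].
  - by apply/set0Pn; exists x0; rewrite inE x0Z /i eqxx.
  - move=> u v; rewrite !inE => /andP[uZ /eqP du] /andP[H vZ].
    apply: contra H => euv; rewrite vZ /= -du.
    have evu : e v u by rewrite sym_e.
    apply/eqP/eq_of_parity; rewrite ?oddZ //; exact: dE.
have rZ z : z \in Z -> r z = r x0.
  suff <- : [set z in Z | r z == r x0] = Z by rewrite inE => /andP[_ /eqP].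
  apply: (critical_connected sym_e k20 Zc).
  - by apply/subsetP => y; rewrite inE => /andP[].
  - by apply/set0Pn; exists x0; rewrite inE x0Z eqxx.
  - move=> u v; rewrite !inE => /andP[uZ /eqP du] /andP[H vZ].
    by apply: contra H => euv; rewrite vZ /= -du (rE _ _ euv).
pose const h := [forall x in Z, forall y in Z, iter h par x == iter h par y].
have constP h : reflect {in Z &, forall x y, iter h par x = iter h par y} (const h).
  apply: (iffP forall_inP) => [H x y xZ yZ|H x xZ].
    by have /forall_inP/(_ y yZ)/eqP := H x xZ.
  by apply/forall_inP => y yZ; apply/eqP; apply: H.
(* Climbing [i] levels from any vertex of [Z] reaches the common root. *)
have consti : const i.
  apply/constP; suff H z : z \in Z -> iter i par z = r x0.
    by move=> x y xZ yZ; rewrite !H.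
  move=> zZ; rewrite -(rZ z zZ).
  suff H j : (j <= i)%N -> r (iter j par z) = r z.
    rewrite -(H i (leqnn i)) r0 // (depth_iter_parent parP) ?(dZ z zZ) ?subnn //.
  elim: j => // j IH ji; rewrite -IH ?(ltnW ji) // iterS; apply/esym/rE.
  apply: (proj1 (parP _ _)).
  by rewrite (depth_iter_parent parP) (dZ z zZ); lia.
case: (ex_minnP (ex_intro const i consti)) => -[|h] hc hmin.
  (* Height zero would make [Z] a single vertex, whose ratio 1 is below [k / 2]. *)
  exfalso; move/constP: hc => /= hc.
  have : Z \subset [set x0] by apply/subsetP => z zZ; rewrite inE (hc z x0).
  move=> /subset_leq_card; rewrite cards1 -(ler_nat R) => c1.
  have : 1 <= (alpha e Z)%:R :> R by rewrite ler1n alpha_gt0.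
  move=> a1; have := ler_wpM2l k20 a1; lra.
have hi : (h < i)%N by apply: hmin.
have : ~~ const h by apply/negP => /hmin; rewrite ltnn.
rewrite negb_forall => /existsP[x1]; rewrite negb_imply => /andP[x1Z].
rewrite negb_forall => /existsP[x2]; rewrite negb_imply => /andP[x2Z x12].
move/constP: hc => hc.
pose side z := iter h par z == iter h par x1.
have [b' [Z' /subsetP Z'Z Z'c]] := critical_half side k20 Z0 kZ.
have sZ' z : z \in Z' -> z \in Z /\ side z = b'.
  by move=> /Z'Z; rewrite inE => /andP[-> /eqP].
have [y [yZ sy]] : exists y, y \in Z /\ side y = ~~ b'.
  case: (b'); [exists x2|exists x1]; rewrite /side ?eqxx //.
  by rewrite eq_sym (negbTE x12).
have yZ' : y \notin Z' by apply/negP => /sZ'[_]; rewrite sy; case: (b').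
have [Z'0 _ _] := Z'c; case/set0Pn: (Z'0) => z0 z0Z'.
have [p0 [pp0 lp0 up0 p0Z]] := critical_path k20 Zc (proj1 (sZ' z0 z0Z')) yZ.
have hp0 : has (mem Z') (z0 :: p0) by rewrite /= z0Z'.
(* [q] is the last vertex of [Z'] on the way to [y], so [p] avoids [Z'] and can follow any path of
   [Z'] ending at [q]. *)
have [q [p [qZ' pp lp np sp]]] := last_exit pp0 hp0.
have up := subseq_uniq sp up0.
have pZ : {subset q :: p <= Z} by move=> z /(mem_subseq sp)/p0Z.
rewrite lp0 in lp.
have [u [pu uu uZ' su]] : exists u : seq T,
    [/\ path e q u, uniq (q :: u), {subset q :: u <= Z'} & (s <= size u)%N].
  apply: (expander_path sym_e) => // S SZ S0 Ss.
  (* A maximum independent set [I] of [S] gives a closed neighbourhood of size at least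
     [k / 4 * alpha e S], hence at least [4 * #|S|]. *)
  have [I [IS iI cI]] := alpha_witness e S.
  have h1 := critical_expand sym_e k40 Z'c (subset_trans IS SZ) iI.
  have h2 := subset_leq_card (closed_nbhdS e Z' IS).
  have h3 := sparse S S0 Ss.
  have h4 : 0 < #|S|%:R :> R by rewrite ltr0n card_gt0.
  move: h2; rewrite -(ler_nat R) => h2; rewrite -(ltr_nat R) natrM.
  by rewrite -cI in h3; lra.
exists (size p + 2 * h.+1)%N => j js.
pose w := take j u.
have pw : path e q w by apply: take_path.
have ww : subseq (q :: w) (q :: u) by rewrite /= eqxx take_subseq.
have E : last q w :: rev (belast q w) = rev (q :: w) by rewrite [q :: w]lastI rev_rcons.
have sw : size w = j by rewrite size_takel // (leq_trans js).
have wZ' : {subset q :: w <= Z'} by move=> z /(mem_subseq ww)/uZ'.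
have l' : last (last q w) (rev (belast q w)) = q.
  have : last q (last q w :: rev (belast q w)) = q.
    by rewrite E rev_cons last_rcons.
  by [].
have -> : (size p + 2 * h.+1 + j = size (rev (belast q w) ++ p) + 2 * h.+1)%N.
  by rewrite size_cat size_rev size_belast sw; clear; lia.
have lZ' : last q w \in Z' by apply/wZ'/mem_last.
apply: (cycle_through_ancestor parP (i := i) (a := last q w)).
- move=> z; rewrite -cat_cons E mem_cat mem_rev => /orP[/wZ'/sZ'[zZ _]|zp].
    exact: dZ.
  by apply: dZ; apply: pZ; rewrite inE zp orbT.
- rewrite cat_path l' pp andbT rev_path.
  by apply: sub_path pw => u1 u2 /=; rewrite sym_e.
- rewrite -cat_cons E cat_uniq rev_uniq (subseq_uniq ww uu) /=.
  move: up => /= /andP[_ ->]; rewrite andbT.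
  apply: contra np => /hasP[z zp]; rewrite mem_rev => /wZ' zZ'.
  by apply/hasP; exists z.
- exact: hi.
- rewrite last_cat l' lp; have [_ sl] := sZ' _ lZ'.
  apply/eqP => H; move: sy; rewrite /side -H -/(side (last q w)) sl.
  by case: (b').
- rewrite last_cat l' lp; apply: hc => //.
  by case: (sZ' _ lZ').
Qed.

End Levels.

(* Numerical estimates and the supremum *)
From mathcomp Require Import classical_sets reals exp.

(* The constant [2 ^- 54] makes the size bound smaller than 1, so that there is
   nothing to prove, as long as [k < 2 ^+ 18]. *)
Lemma small_set_sparse (R : realType) (k : R) (T : finType) (e : rel T)
    (S : {set T}) :
  symmetric e -> irreflexive e -> triangle_free e ->
  3 <= k -> S != finset.set0 -> #|S|%:R <= 2 ^- 54 * k ^+ 2 * ln k ->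
  16 * #|S|%:R <= k * (alpha e S)%:R.
Proof.
move=> sym irr tf k3 S0 Sk.
have k0 : 0 < k by lra.
have lnk0 : 0 < ln k by apply: ln_gt0; lra.
have n1 : 1 <= #|S|%:R :> R by rewrite ler1n card_gt0.
have c0 : 0 < 2 ^- 54 :> R by rewrite invr_gt0 exprn_gt0.
have cE : 2 ^- 54 * 2 ^+ 54 = 1 :> R by rewrite mulVf // expf_neq0 // pnatr_eq0.
have kbig : 2 ^+ 18 <= k.
  rewrite leNgt; apply/negP => klt.
  have h1 : k ^+ 2 * ln k < k ^+ 3.
    by rewrite (exprSr k 2) ltr_pM2l ?exprn_gt0 // ln_sublinear.
  have h2 : k ^+ 3 <= (2 ^+ 18) ^+ 3 by rewrite lerXn2r ?nnegrE ?exprn_ge0 ?ltW.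
  rewrite -exprM in h2.
  have h3 : 2 ^- 54 * (k ^+ 2 * ln k) < 2 ^- 54 * 2 ^+ 54.
    by rewrite ltr_pM2l //; apply: lt_le_trans h1 h2.
  by rewrite cE mulrA in h3; lra.
have [t [t0 a4 nt]] := card_le_alpha_log sym irr tf S0.
have a1 := alpha_gt0 irr S0.
rewrite leNgt; apply/negP => ka.
move: (alpha e S) a4 nt a1 ka => a a4 nt a1 ka.
move: nt; rewrite -(ler_nat R) !natrM => nt.
have {}a1 : 0 < a%:R :> R by rewrite ltr0n.
have {}t0 : 1 <= t%:R :> R by rewrite ler1n.
have {}a4 : a%:R < 4 ^+ t :> R by rewrite -natrX ltr_nat.
(* Multiply [k * a < 16 * #|S|] by [t], insert [#|S| * t <= 32 * a ^ 2], and cancel [a]. *)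
have kt : k * t%:R <= 512 * a%:R.
  rewrite -(ler_pM2r a1); have : k * a%:R * t%:R <= 16 * #|S|%:R * t%:R.
    by apply: ler_wpM2r; [lra|exact: ltW].
  by nra.
have k4 : k < 512 * 4 ^+ t.
  apply: (@le_lt_trans _ _ (k * t%:R)); first by rewrite ler_peMr // ltW.
  by apply: le_lt_trans kt _; rewrite ltr_pM2l.
(* Squaring the previous bound gives [k ^ 2 < 2 ^ 18 * 16 ^ t], and [2 ^ 18 <= k] absorbs the
   constant. *)
have k16 : k < 16 ^+ t.
  have -> : 16 = 4 ^+ 2 :> R by ring.
  rewrite -exprM mulnC exprM.
  have q0 : 0 < 4 ^+ t :> R by rewrite exprn_gt0.
  move: (4 ^+ t) k4 q0 => q k4 q0.
  have h : k ^+ 2 < (512 * q) ^+ 2 by rewrite ltrXn2r // ?nnegrE; lra.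
  have h2 : 2 ^+ 18 * q ^+ 2 <= k * q ^+ 2.
    by apply: ler_wpM2r => //; rewrite exprn_ge0 // ltW.
  rewrite -(ltr_pM2l k0) -expr2; apply: lt_le_trans h _.
  by rewrite exprMn (_ : 512 ^+ 2 = 2 ^+ 18) //; ring.
have lnt : ln k <= 16 * t%:R.
  have h : ln k < ln (16 ^+ t) by rewrite ltr_ln ?posrE ?exprn_gt0.
  rewrite lnXn // in h; apply: ltW; apply: lt_le_trans h _.
  rewrite -[leLHS]mulr_natr ler_wpM2r //.
  exact/ltW/ln_sublinear.
have h1 : k * (k * ln k) <= k * (16 * (512 * a%:R)).
  rewrite ler_pM2l //; apply: (@le_trans _ _ (k * (16 * t%:R))).
    by rewrite ler_pM2l.
  by rewrite mulrCA ler_wpM2l.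
have h2 : 2 ^- 54 * 2 ^+ 17 <= 1 :> R
  by rewrite -[leRHS]cE; apply: ler_wpM2l; [exact: ltW|rewrite ler_weXn2l // ler1n].
have h3 : 0 <= k * a%:R by apply: mulr_ge0; apply: ltW.
have h4 := ler_wpM2l (ltW c0) h1.
(* The exponent 17 comes from [16 * 512 = 2 ^ 17 / 16]. *)
have h5 : #|S|%:R <= 2 ^- 54 * 2 ^+ 17 * (k * a%:R * 16^-1).
  apply: le_trans Sk _.
  have -> : 2 ^- 54 * k ^+ 2 * ln k = 2 ^- 54 * (k * (k * ln k)) by ring.
  apply: le_trans h4 _; rewrite -mulrA ler_pM2l //.
  have -> : k * (16 * (512 * a%:R)) = 16 * 512 * (k * a%:R) by ring.
  lra.
have h6 : 2 ^- 54 * 2 ^+ 17 * (k * a%:R * 16^-1) <= 1 * (k * a%:R * 16^-1).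
  by apply: ler_wpM2r => //; lra.
lra.
Qed.

(** There are finitely many [X], so the supremum is a maximum. A graph without vertices is excluded
    because its supremum is 0. *)
Lemma indep_ratio_attained (R : realType) (T : finType) (e : rel T) (k : R) :
  irreflexive e -> 0 < k -> k <= indep_ratio R e ->
  exists2 X : {set T}, X != finset.set0 & k * (alpha e X)%:R <= #|X|%:R.
Proof.
move=> irr k0 ki.
case: (boolP [exists X : {set T},
  (X != finset.set0) && (k * (alpha e X)%:R <= #|X|%:R)]) => [/exists_inP//|].
rewrite negb_exists => /forallP H; exfalso.
have lt (X : {set T}) : X != finset.set0 -> #|X|%:R / (alpha e X)%:R < k.
  move=> X0; rewrite ltr_pdivrMr ?ltr0n ?alpha_gt0 // ltNge.
  by have := H X; rewrite X0.
have [x _|T0] := pickP (fun _ : T => true); last first.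
  move: ki; rewrite /indep_ratio (_ : [set _ | _ in _]%classic = classical_sets.set0).
    by rewrite sup0; lra.
  apply/seteqP; split=> // y [X /= /set0Pn[x _]]; by have := T0 x.
have s0 : [set x] != finset.set0 by apply/set0Pn; exists x; rewrite inE.
pose ratio (X : {set T}) : R := #|X|%:R / (alpha e X)%:R.
case: (@Order.TotalTheory.arg_maxP _ R _ [set x] (fun X => X != finset.set0) ratio s0).
move=> X X0 max.
have : indep_ratio R e <= ratio X.
  apply: ge_sup; first by exists (ratio [set x]), [set x].
  by move=> _ [Y /= Y0 <-]; apply: max.
by have := lt X X0; rewrite -/(ratio X); lra.
Qed.

Theorem theorem1 (R : realType) :
  exists2 c : R, 0 < c &
    forall (k : R) (T : finType) (e : rel T),
      3 <= k ->
      symmetric e -> irreflexive e ->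
      triangle_free e ->
      k <= indep_ratio R e ->
      exists m : nat, forall l : nat,
        (m <= l)%N -> l%:R < m%:R + c * k ^+ 2 * ln k ->
        has_cycle_of_length e l.
Proof.
exists (2 ^- 54); first by rewrite invr_gt0 exprn_gt0.
move=> k T e k3 sym irr tf ki.
have k0 : 0 < k by lra.
have [X X0 kX] := indep_ratio_attained irr k0 ki.
set L := 2 ^- 54 * k ^+ 2 * ln k.
have L0 : 0 <= L.
  rewrite /L !mulr_ge0 ?invr_ge0 ?exprn_ge0 ?ln_ge0 //; lra.
have [S S0|m cyc] := consecutive_cycles (s := Num.truncn L) sym irr k3 X0 kX.
  rewrite truncn_ge_nat // => SL; exact: small_set_sparse.
exists m => l ml lL; rewrite -(subnKC ml); apply: cyc.
by rewrite truncn_ge_nat // natrB //; lra.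
Qed.
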